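(* The space $\beta\mathbf{R}\times\beta\mathbf{R}$ is not rr-good, where $\beta\mathbf{R}$ is the Stone–Čech compactification of the real line $\mathbf{R}$.
   Context: For a Tychonoff space $X$, $\mathrm{C}(X)$ is the ring of continuous real-valued functions on $X$. It is partially ordered by the reduced ring order: $f\le_{\mathrm{rr}} g$ if and only if $f^2=fg$. The space $X$ is called rr-good if every pair $f,g\in \mathrm{C}(X)$ has an infimum (greatest lower bound) in the partial order $\le_{\mathrm{rr}}$. *)

(* Defs.v *)
From HB Require Import structures.
From mathcomp Require Import all_boot all_order all_algebra.
From mathcomp Require Import all_classical all_reals all_analysis.

Set Implicit Arguments.
Unset Strict Implicit.
Unset Printing Implicit Defensive.

Import Order.TTheory GRing.Theory Num.Theory.
Import numFieldNormedType.Exports.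

Local Open Scope classical_set_scope.
Local Open Scope ring_scope.

Section RRGood.
Variables (R : realType) (X : topologicalType).
Implicit Types f g h k : continuousType X R.

(* Products are taken in the (pointwise) ring of functions X -> R, of which
   C(X) is a subring. *)
Definition rr_le f g : Prop := (f : X -> R) ^+ 2 = (f : X -> R) * (g : X -> R).

Definition is_rr_inf f g h : Prop :=
  [/\ rr_le h f, rr_le h g & forall k, rr_le k f -> rr_le k g -> rr_le k h].

Definition rr_good : Prop := forall f g, exists h, is_rr_inf f g h.

End RRGood.

(* The Stone-Cech compactification of X, built as the closure of the image of X
   in [0, 1] ^ C(X, [0, 1]) under evaluation.  The factors are copies of R
   rather than of [0, 1]; as [0, 1] ^ C(X, [0, 1]) is closed in
   R ^ C(X, [0, 1]), the closure is the same. *)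
Section StoneCech.
Variables (R : realType) (X : topologicalType).

Definition unit_fun : set (continuousType X R) :=
  [set f | forall x, 0 <= f x <= 1].

Definition stone_cech_cube : topologicalType :=
  prod_topology (fun _ : unit_fun => (R : topologicalType)).

Definition stone_cech_eval : X -> stone_cech_cube :=
  fun x f => set_val f x.

Definition stone_cech : topologicalType :=
  set_type (closure (range stone_cech_eval)).

Lemma stone_cech_embed_subproof x :
  stone_cech_eval x \in closure (range stone_cech_eval).
Proof. by apply/mem_set/subset_closure; exists x. Qed.

Definition stone_cech_embed (x : X) : stone_cech :=
  exist _ (stone_cech_eval x) (stone_cech_embed_subproof x).

Lemma stone_cech_embed_continuous : continuous stone_cech_embed.
Proof.
have ctse : continuous stone_cech_eval.
  move=> x; apply/cvg_sup => f; apply/cvg_image.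
    by rewrite eqEsubset; split=> y // _; exists (fun=> y).
  move=> A /= /(@cts_fun _ _ (set_val f) x) fA.
  exists ((fun p : stone_cech_cube => p f) @^-1` A); first exact: fA.
  by apply: image_preimage; rewrite eqEsubset; split=> y // _; exists (fun=> y).
apply/continuousP => _ [B oB <-].
by move/continuousP : ctse => /(_ _ oB).
Qed.

Lemma stone_cech_embed_dense : dense (range stone_cech_embed).
Proof.
move=> O [[p pP] Op] [B oB BO]; subst O.
have [|q [[x _ <-] Bx]] := set_mem pP B; first exact: open_nbhs_nbhs.
by exists (stone_cech_embed x); split => //; exists x.
Qed.

Lemma stone_cech_hausdorff : hausdorff_space stone_cech.
Proof.
have hc : hausdorff_space stone_cech_cube.
  by apply: hausdorff_product => ?; exact: Rhausdorff.
move=> p q pq; apply/val_inj/hc => A B pA qB.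
have [] := pq (set_val @^-1` A) (set_val @^-1` B).
- exact: (@initial_continuous _ _ set_val p).
- exact: (@initial_continuous _ _ set_val q).
- by move=> r [Ar Br]; exists (set_val r).
Qed.

Lemma stone_cech_compact : compact [set: stone_cech].
Proof.
have cc : compact (closure (range stone_cech_eval)).
  apply: (@subclosed_compact _ _
      [set p : stone_cech_cube | forall f, p f \in `[0, 1]]).
  - exact: closed_closure.
  - by apply: (@tychonoff _ (fun=> R : topologicalType)
        (fun=> `[0, 1]%classic)) => ?; exact: segment_compact.
  - have cl : closed [set p : stone_cech_cube | forall f, p f \in `[0, 1]].
      apply: compact_closed.
        by apply: hausdorff_product => ?; exact: Rhausdorff.
      by apply: (@tychonoff _ (fun=> R : topologicalType)
        (fun=> `[0, 1]%classic)) => ?; exact: segment_compact.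
    rewrite [X in _ `<=` X](closure_id _).1 //; apply: closure_subset.
    by move=> _ [x _ <-] f /=; rewrite in_itv/=; exact: (set_valP f).
move=> F FF _; have [|p [cp Fp]] := cc (set_val @ F) _.
  apply: (@filterS _ F _ setT); last exact: filterT.
  by move=> q _; exact: set_valP.
exists (exist _ p (mem_set cp)); split => // A V FA [W [[B oB BW] Wp] WV]; subst W.
have [||_ [[q Aq <-] /= Bq]] := Fp (set_val @` A) B.
- by apply: (@filterS _ F _ A) FA => q Aq; exists q.
- exact: open_nbhs_nbhs.
- by exists q; split => //; exact: WV.
Qed.

(* With density, compactness and separation, this characterizes stone_cech. *)
Lemma stone_cech_extend (f : continuousType X R) :
  (forall x, 0 <= f x <= 1) ->
  exists2 F : continuousType stone_cech R,
    (forall p, 0 <= F p <= 1) & forall x, F (stone_cech_embed x) = f x.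
Proof.
move=> f01; pose i : unit_fun := exist _ f (mem_set f01).
pose F (p : stone_cech) : R := set_val p i.
have Fc : continuous F.
  move=> p; apply: (@continuous_comp stone_cech stone_cech_cube R set_val
      (@proj unit_fun (fun=> R) i)).
    exact: initial_continuous.
  exact: (@proj_continuous unit_fun (fun=> R : topologicalType)).
exists (mkcts Fc) => // p.
have cl : closed ([set q | 0 <= F q <= 1]).
  have -> : [set q | 0 <= F q <= 1] = F @^-1` `[0, 1].
    by apply/seteqP; split=> q /=; rewrite in_itv.
  by apply: closed_comp => [? _|]; [exact: Fc | exact: itv_closed].
apply: contrapT => np.
have [|q [nq [x _ xq]]] :=
    @stone_cech_embed_dense (~` [set q | 0 <= F q <= 1]) _ (closed_openC cl).
  by exists p.
by apply: nq; rewrite -xq; exact: f01.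
Qed.

End StoneCech.

(* Main.v *)
Require Import Defs.
From mathcomp Require Import all_boot all_order all_algebra.
From mathcomp Require Import all_classical all_reals all_analysis.
From mathcomp Require Import ring lra.
Import numFieldNormedType.Exports.
Import Order.TTheory GRing.Theory Num.Theory.

(** An infimum of [f] and [g] in C(X) is forced in two ways.  It vanishes
wherever [f] and [g] differ, and it agrees with [k] wherever [k] is nonzero,
for each common lower bound [k].  Common lower bounds of [f] and [g] arise by
cutting [f] down to a clopen piece of its cozero set on which [f = g]; a
supremum of infinitely many such pieces may fail to be continuous.

On the line, let [comb] be a function whose cozero set is a disjoint union of
open intervals, let [I_0], [I_1], ... be infinitely many of these, let [tooth n]
be the restriction of [comb] to [I_n], with peak [x_n], and let [plateau] be a
bounded function that is constant on each [I_n], with distinct constants for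
distinct [n].  These are bounded, so they extend to continuous functions [A],
[B n], [V] on the compactification.  On the square put [f (p, q) = A p * A q]
and [g (p, q) = f (p, q) + (V p - V q)].  Over the rectangle [I_n * I_m], [f]
and [g] agree if [n = m] and differ everywhere otherwise.  Each [B n p * B n q]
is a common lower bound, so an infimum [h] would satisfy [h (x_n, x_n) = 1],
whereas [h (x_n, x_m) = 0] for distinct [n] and [m]
([not_rr_good_square]).  No continuous [h] on the square of a compact space does
this: it would be discontinuous at [(p, p)] for any cluster point [p] of the
sequence [x_n] ([compact_no_kronecker_function]).

Trigonometric functions provide [comb], [tooth n] and [plateau] in closed form,
so their continuity needs no gluing or infinite sum. *)

Set Implicit Arguments.
Unset Strict Implicit.
Unset Printing Implicit Defensive.

Local Open Scope classical_set_scope.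
Local Open Scope ring_scope.

(** * Kronecker deltas on the square of a compact space *)

(** Every neighbourhood of [(p, p)], with [p] a cluster point of [x], contains
some [(x n, x n)] together with some [(x n, x m)], [m > n], and [h] takes the
values 1 and 0 there. *)
Lemma compact_no_kronecker_function (R : realType) (X : topologicalType)
    (h : X * X -> R) (x : nat -> X) :
  compact [set: X] -> continuous h ->
  ~ (forall n m, h (x n, x m) = (n == m)%:R).
Proof.
move=> cX ch hx.
have [|p [_ clp]] := cX (x @ \oo) _; first exact: filterT.
have /ch : nbhs (h (p, p)) (ball (h (p, p)) (2^-1)).
  by apply: nbhsx_ballx; rewrite invr_gt0.
case=> -[/= A B] [pA pB] AB.
pose W := A `&` B.
have pW : nbhs p W by exact: filterI.
have freq N : exists2 n, (N <= n)%N & W (x n).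
  have [|_ [[n /= Nn <-] Wn]] :=
    clp [set x n | n in [set n | (N <= n)%N]] W _ pW.
    by exists N => // n /= Nn; exists n.
  by exists n.
have [n _ [An Bn]] := freq 0%N.
have [m nm [Am Bm]] := freq n.+1.
have := AB (x n, x n) (conj An Bn); have := AB (x n, x m) (conj An Bm).
rewrite /ball /= !hx eqxx (ltn_eqF nm) /= => h0 h1.
have := ler_distD (h (p, p)) 0 (1 : R).
rewrite sub0r normrN normr1 [`|0 - _|]distrC => /le_lt_trans/(_ (ltrD h0 h1)).
by rewrite -[X in _ < X]/(2^-1 + 2^-1) => ?; lra.
Qed.

(** * A criterion for squares that are not rr-good *)

Lemma continuous_eq_on_dense (R : realType) (X : topologicalType) (D : set X)
    (F G : X -> R) :
  dense D -> continuous F -> continuous G ->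
  (forall p, D p -> F p = G p) -> forall p, F p = G p.
Proof.
move=> dD cF cG FG p; apply/eqP; rewrite -subr_eq0; apply/negPn/negP => FGp.
pose E q := F q - G q.
have cE : continuous E by move=> q; apply: cvgB; [exact: cF|exact: cG].
have oE : open (E @^-1` [set r | r != 0]).
  by apply: open_comp => [q _|]; [exact: cE|exact: open_neq].
have [|q [Eq Dq]] := dD _ _ oE; first by exists p.
by move: Eq; rewrite /E /= (FG q Dq) subrr eqxx.
Qed.

(** The hypotheses say that the [b n] are pieces of [a] over disjoint clopen
parts of its cozero set, and that [v] separates these parts while being constant
on each.  The identities are asked on a dense set only, so that for a
compactification they can be checked on the original space. *)
Lemma not_rr_good_square (R : realType) (X : topologicalType) (D : set X)
    (a v : X -> R) (b : nat -> X -> R) (c : nat -> R) (x : nat -> X) :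
  compact [set: X] -> dense D -> continuous a -> continuous v ->
  (forall n, continuous (b n)) -> injective c ->
  (forall n p, D p -> b n p ^+ 2 = b n p * a p) ->
  (forall n p, D p -> b n p * v p = b n p * c n) ->
  (forall n, b n (x n) = 1) ->
  ~ rr_good R (X * X)%type.
Proof.
move=> cX dD ca cv cb c_inj bbD bvD bx good.
have bb n : forall p, b n p ^+ 2 = b n p * a p.
  apply: (continuous_eq_on_dense dD _ _ (bbD n)) => p.
  - by apply: cvgM; exact: cb.
  - by apply: cvgM; [exact: cb|exact: ca].
have bv n : forall p, b n p * v p = b n p * c n.
  apply: (continuous_eq_on_dense dD _ _ (bvD n)) => p.
  - by apply: cvgM; [exact: cb|exact: cv].
  - by apply: cvgM; [exact: cb|exact: cvg_cst].
have cfst (u : X -> R) : continuous u -> continuous (fun p : X * X => u p.1).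
  by move=> cu p; apply: (continuous_comp (@cvg_fst _ _ _ _ _) (cu _)).
have csnd (u : X -> R) : continuous u -> continuous (fun p : X * X => u p.2).
  by move=> cu p; apply: (continuous_comp (@cvg_snd _ _ _ _ _) (cu _)).
pose f0 (p : X * X) : R := a p.1 * a p.2.
pose g0 (p : X * X) : R := f0 p + (v p.1 - v p.2).
pose k0 n (p : X * X) : R := b n p.1 * b n p.2.
have cf : continuous f0.
  by move=> p; apply: cvgM; [exact: cfst|exact: csnd].
have cg : continuous g0.
  by move=> p; apply: cvgD; [exact: cf|apply: cvgB; [exact: cfst|exact: csnd]].
have ck n : continuous (k0 n).
  by move=> p; apply: cvgM; [exact: (cfst _ (cb n))|exact: (csnd _ (cb n))].
have vx n : v (x n) = c n by have := bv n (x n); rewrite bx !mul1r.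
have kf n p : k0 n p ^+ 2 = k0 n p * f0 p.
  by rewrite /k0 /f0 exprMn !bb; ring.
have kg n p : k0 n p ^+ 2 = k0 n p * g0 p.
  rewrite kf /g0 mulrDr.
  suff -> : k0 n p * (v p.1 - v p.2) = 0 by rewrite addr0.
  rewrite /k0 mulrBr [_ * b n p.2 * v p.1]mulrAC bv -[_ * v p.2]mulrA bv.
  by ring.
have [h [hf hg hmax]] := good (mkcts cf) (mkcts cg).
apply: (@compact_no_kronecker_function R X h x cX); first exact: cts_fun.
move=> n m.
have hfx p : h p ^+ 2 = h p * f0 p by exact: (congr1 (fun u => u p) hf).
have hgx p : h p ^+ 2 = h p * g0 p by exact: (congr1 (fun u => u p) hg).
have [<-|/eqP nm] := eqVneq n m.
  have kh : rr_le (mkcts (ck n)) h.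
    by apply: hmax; apply/funext => p; [exact: kf|exact: kg].
  have : k0 n (x n, x n) ^+ 2 = k0 n (x n, x n) * h (x n, x n).
    exact: (congr1 (fun u => u (x n, x n)) kh).
  by rewrite /k0 /= bx !mul1r expr1n.
(* Off the diagonal, [f0] and [g0] differ at [(x n, x m)], so [h] vanishes. *)
have := hgx (x n, x m).
rewrite hfx /g0 mulrDr /= !vx => /eqP.
rewrite -subr_eq0 opprD addNKr oppr_eq0 mulf_eq0 subr_eq0 => /orP[/eqP//|].
by move=> /eqP/c_inj.
Qed.

(** * A comb and a staircase on the line *)

Section Line.
Variable R : realType.
Implicit Types x y : R.

(** The cozero set is [cos x > 1/2], an interval about each multiple of 2 pi. *)
Definition comb x : R := Num.max 0 (2 * cos x - 1).

(** The tooth of the comb at 0.  Clamping the argument to an interval whose ends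
are zeros of the comb removes all other teeth and preserves continuity. *)
Definition bump y : R :=
  comb (Num.max (- (pi / 2)) (Num.min (pi / 2) y)).

(** Where [cos x > 1/2] the quotient is [tan x], so the value is the centre
of the tooth that contains [x]: the staircase is flat under each tooth.
The lower bound on the denominator keeps it continuous elsewhere. *)
Definition staircase x : R := x - atan (sin x / Num.max 2^-1 (cos x)).

(** A bounded function of the staircase, injective on nonnegative heights. *)
Definition plateau x : R := (1 + staircase x ^+ 2)^-1.

Definition node n : R := pi *+ 2 *+ n.

Lemma continuous_comb : continuous comb.
Proof.
apply: max_fun_continuous => x; first exact: cvg_cst.
by apply: cvgB; [apply: cvgMr; exact: continuous_cos|exact: cvg_cst].
Qed.

Lemma continuous_bump : continuous bump.
Proof.
have cclamp :
    continuous (fun y : R => Num.max (- (pi / 2)) (Num.min (pi / 2) y)).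
  apply: (@max_fun_continuous _ _ R (fun=> - (pi / 2))) => [y|].
    exact: cvg_cst.
  apply: (@min_fun_continuous _ _ R (fun=> pi / 2) id) => y //.
  exact: cvg_cst.
by move=> y; apply: (continuous_comp (cclamp y)); exact: continuous_comb.
Qed.

Lemma continuous_staircase : continuous staircase.
Proof.
have cmax : continuous (fun x : R => Num.max 2^-1 (cos x)).
  apply: (@max_fun_continuous _ _ R (fun=> 2^-1) cos) => [y|].
    exact: cvg_cst.
  exact: continuous_cos.
have cquo : continuous (fun x : R => sin x / Num.max 2^-1 (cos x)).
  move=> x; apply: cvgM; first exact: continuous_sin.
  by apply: cvgV; [rewrite gt_eqF// lt_max invr_gt0 ltr0n|exact: cmax].
move=> x; apply: cvgB; first exact: cvg_id.
exact: (continuous_comp (cquo x) (@continuous_atan R _)).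
Qed.

Lemma continuous_plateau : continuous plateau.
Proof.
have csqr : continuous (fun x : R => staircase x ^+ 2).
  by move=> x; apply: cvgM; exact: continuous_staircase.
move=> x; apply: cvgV; first by rewrite gt_eqF// ltr_pwDl// sqr_ge0.
by apply: cvgD; [exact: cvg_cst|exact: csqr].
Qed.

Lemma comb_unit x : 0 <= comb x <= 1.
Proof.
rewrite /comb le_max lexx/= ge_max ler01/=.
by have := cos_le1 x; lra.
Qed.

Lemma plateau_unit x : 0 <= plateau x <= 1.
Proof.
have s0 := sqr_ge0 (staircase x).
by rewrite /plateau invr_ge0 addr_ge0//= invf_le1 ?lerDl// ltr_pwDl.
Qed.

Lemma comb_node x n : comb (x + node n) = comb x.
Proof. by rewrite /comb (periodicn (@cosD2pi R)). Qed.

Lemma staircase_node x n : staircase (x + node n) = staircase x + node n.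
Proof.
rewrite /staircase (periodicn (@cosD2pi R)) (periodicn (@sinD2pi R)).
by rewrite addrAC.
Qed.

(** Beyond the clamping interval the bump is the value of the comb at one of the
points [pi / 2], [- pi / 2], which is 0. *)
Lemma bump_neq0 y : bump y != 0 ->
  [/\ bump y = comb y, - (pi / 2) < y < pi / 2 & 2^-1 < cos y].
Proof.
have pi0 : 0 < pi / 2 :> R by case/andP: (@pihalf_02 R).
have cpi : comb (pi / 2) = 0.
  by rewrite /comb cos_pihalf mulr0 sub0r max_l// oppr_le0 ler01.
have cNpi : comb (- (pi / 2)) = 0.
  by rewrite /comb cosN cos_pihalf mulr0 sub0r max_l// oppr_le0 ler01.
rewrite /bump; have [yl|ly] := leP (pi / 2) y.
  by rewrite max_r ?cpi ?eqxx//; lra.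
have [yN|Ny] := leP y (- (pi / 2)); first by rewrite cNpi eqxx.
rewrite /comb; have [_|cy] := leP (2 * cos y - 1) 0; first by rewrite eqxx.
by move=> _; split => //; lra.
Qed.

Lemma bump_sqr y : bump y ^+ 2 = bump y * comb y.
Proof.
have [->|/bump_neq0[-> _ _]] := eqVneq (bump y) 0; last exact: expr2.
by rewrite mul0r expr0n.
Qed.

Lemma staircase_bump y : bump y != 0 -> staircase y = 0.
Proof.
move=> /bump_neq0[_ ypi cy].
by rewrite /staircase max_r ?(ltW cy)// tanK ?subrr// in_itv.
Qed.

Lemma bump0 : bump 0 = 1.
Proof.
have /andP[pi0 _] := @pihalf_02 R.
rewrite /bump min_r ?(ltW pi0)// max_r ?oppr_le0 ?(ltW pi0)//.
by rewrite /comb cos0 max_r; lra.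
Qed.

Definition tooth n x : R := bump (x - node n).

Definition level n : R := (1 + node n ^+ 2)^-1.

Lemma continuous_tooth n : continuous (tooth n).
Proof.
move=> x; apply: (@continuous_comp _ _ _ (fun x => x - node n)).
  by apply: cvgB; [exact: cvg_id|exact: cvg_cst].
exact: continuous_bump.
Qed.

Lemma tooth_sqr n x : tooth n x ^+ 2 = tooth n x * comb x.
Proof.
by rewrite /tooth bump_sqr -[in RHS](subrK (node n) x) comb_node addrK.
Qed.

(** The plateau is constant on the n-th tooth since the staircase is 0 on the
tooth at 0 and climbs by [node n] under translation by [node n]. *)
Lemma tooth_plateau n x : tooth n x * plateau x = tooth n x * level n.
Proof.
rewrite /tooth; have [->|/staircase_bump s0] := eqVneq (bump (x - node n)) 0.
  by rewrite !mul0r.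
by rewrite /plateau -[in staircase _](subrK (node n) x) staircase_node s0 add0r.
Qed.

Lemma tooth_self n : tooth n (node n) = 1.
Proof. by rewrite /tooth subrr bump0. Qed.

Lemma level_inj : injective level.
Proof.
move=> n m /invr_inj/addrI/eqP.
have node_ge0 k : 0 <= node k by do 2!apply: mulrn_wge0; exact: pi_ge0.
rewrite eqrXn2// => /eqP; apply: mulrIn.
by rewrite gt_eqF// mulrn_wgt0// pi_gt0.
Qed.

End Line.

Theorem theorem2p9 (R : realType) :
  ~ rr_good R (stone_cech R R * stone_cech R R)%type.
Proof.
have [A _ Aa] :=
  stone_cech_extend (f := mkcts (@continuous_comb R)) (@comb_unit R).
have [V _ Vv] :=
  stone_cech_extend (f := mkcts (@continuous_plateau R)) (@plateau_unit R).
have /choice[B Bb] : forall n, exists B : continuousType (stone_cech R R) R,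
    forall x, B (stone_cech_embed R x) = tooth n x.
  move=> n.
  have [x|B _ Bb] := @stone_cech_extend R R (mkcts (@continuous_tooth R n)).
    exact: comb_unit.
  by exists B.
refine (@not_rr_good_square R (stone_cech R R) (range (@stone_cech_embed R R))
  A V B (@level R) (fun n => stone_cech_embed R (node R n))
  _ _ _ _ _ _ _ _ _).
- exact: stone_cech_compact.
- exact: stone_cech_embed_dense.
- exact: cts_fun.
- exact: cts_fun.
- by move=> n; exact: cts_fun.
- exact: level_inj.
- by move=> n _ [x _ <-]; rewrite Bb Aa; exact: tooth_sqr.
- by move=> n _ [x _ <-]; rewrite Bb Vv; exact: tooth_plateau.
- by move=> n; rewrite Bb; exact: tooth_self.
Qed.
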